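(* Let $\mathcal{A}=(V,V_P,E,T)$ be a target arena that equals its own $\sim$-quotient. Then for every family $\mu=(\mu_u)_{u\in V_N}$ of full-support probability distributions, every edge $(w,x)\in E\cap(V_P\times V_N)$ such that $x\unlhd (wE\setminus\{x\})$, and every $v\in V_P$, \[\max_\sigma \mathbb{P}^{\mathcal{A},\mu,\sigma}(v\models\Diamond T)=\max_{\sigma'}\mathbb{P}^{\mathcal{B},\mu,\sigma'}(v\models\Diamond T),\] where $\mathcal{B}=(V,V_P,E\setminus\{(w,x)\},T)$.
   Context: A target arena is a tuple $\mathcal{A}=(V,V_P,E,T)$ where $V$ is finite, $V_P\subseteq V$, $V_N:=V\setminus V_P$, $E\subseteq (V_P\times V_N)\cup(V_N\times V_P)$, $T\subseteq V_P$, and $uE:=\{v\mid (u,v)\in E\}\neq\emptyset$ for all $u\in V_N$. A family of full-support probability distributions is $\mu=(\mu_u)_{u\in V_N}$ with each $\mu_u:uE\to\mathbb{Q}_{>0}$ summing to $1$ (we set $\mu_u(w):=0$ for $w\notin uE$). For a Markov chain with state set $Q$ and transition function $\delta$, $\mathbb{P}(q_0\models\Diamond T')$ is the probability that a run from $q_0$ reaches $T'$ (equal to $1$ if $q_0\in T'$, and otherwise the sum over all $n\ge1$ and words $q_0\dots q_n\in(Q\setminus T')^*T'$ of $\prod_{i<n}\delta(q_i)(q_{i+1})$). A strategy is a function $\sigma:V_P\to V_N$. The arena, $\mu$ and $\sigma$ induce the Markov chain on $V_P\cup\{\bot\}$ in which from $p\in V_P$ the next state is $q$ with probability $\mu_{\sigma(p)}(q)$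 if $(p,\sigma(p))\in E$, and $\bot$ with probability $1$ otherwise; $\bot$ is absorbing. $\mathbb{P}^{\mathcal{A},\mu,\sigma}$ denotes probabilities in this chain (for $\mathcal{B}$, the same construction with edge set $E\setminus\{(w,x)\}$). $\mathrm{Val}^\mu(v):=\max_\sigma\mathbb{P}^{\mathcal{A},\mu,\sigma}(v\models\Diamond T)$ for $v\in V_P$ and $\mathrm{Val}^\mu(u):=\sum_{v\in uE}\mu_u(v)\mathrm{Val}^\mu(v)$ for $u\in V_N$. For $v\in V$, $W\subseteq V$: $v\unlhd W$ iff for every full-support family $\mu$ there exists $w\in W$ with $\mathrm{Val}^\mu(v)\le\mathrm{Val}^\mu(w)$; $v\sim w$ iff $v\unlhd\{w\}$ and $w\unlhd\{v\}$. For $u\in V$, $[u]:=\{v\in V_P\mid v\sim u\}$ if $u\in V_P$, and $[u]:=\{v\in V_N\mid v\sim u\}$ otherwise. The $\sim$-quotient of $\mathcal{A}$ is the target arena $(S,S_P,R,U)$ with $S_P=\{[v]\mid v\in V_P\}$, $S=\{[v]\mid v\in V_N\}\cup S_P$, $U=\{[t]\mid t\in T\}$, $R=\{([u],[v])\mid\exists(u,v)\in E\cap(V_P\times V_N): vE\setminus[u]\neq\emptyset\}\cup\{([u],[v])\mid\exists(u,v)\in E\cap(V_N\times V_P)\}$. ''$\mathcal{A}$ equals its $\sim$-quotient'' means this quotient coincides with $\mathcal{A}$ when each vertex is identified with its singleton class (in particular all classes are singletons). *)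

(* Defs.v *)
From HB Require Import structures.
From mathcomp Require Import all_boot all_order all_algebra.
From mathcomp Require Import all_classical all_reals all_analysis.

Set Implicit Arguments.
Unset Strict Implicit.
Unset Printing Implicit Defensive.

Import Order.TTheory GRing.Theory Num.Theory.

Local Open Scope ring_scope.

(* The finite vertex set is a finite subset of an ambient finType K, so that
   the quotient of an arena over K is again an arena, over {set K}. *)
Record arena (K : finType) := Arena {
  vertices : {set K};
  protagonist : {set K};
  edges : {set K * K};
  targets : {set K} }.

Definition nature (K : finType) (A : arena K) : {set K} :=
  vertices A :\: protagonist A.

Definition succs (K : finType) (A : arena K) (u : K) : {set K} :=
  [set v | (u, v) \in edges A].

Definition target_arena (K : finType) (A : arena K) : Prop :=
  [/\ protagonist A \subset vertices A,
      edges A \subset finset.setX (protagonist A) (nature A)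
                      :|: finset.setX (nature A) (protagonist A),
      targets A \subset protagonist A
    & forall u, u \in nature A -> succs A u != finset.set0].

(* mu u is constrained only for u in V_N; its other values are never used. *)
Definition full_support (K : finType) (A : arena K) (mu : K -> K -> rat) :
    Prop :=
  forall u, u \in nature A ->
    [/\ forall w, w \in succs A u -> 0 < mu u w,
        forall w, w \notin succs A u -> mu u w = 0
      & \sum_(w in succs A u) mu u w = 1].

(* The words of length n + 1 starting in q0 are the q0 :: s with s of size n. *)
Definition reach_prob (R : realType) (Q : finType) (delta : Q -> Q -> rat)
    (T' : {set Q}) (q0 : Q) : \bar R :=
  if q0 \in T' then 1%E else
  (\sum_(1 <= n <oo)
    \sum_(s : n.-tuple Q |
          all (fun q => q \notin T') (belast q0 s) && (last q0 s \in T'))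
      (\prod_(i < n) ratr (delta (nth q0 (q0 :: s) i)
                                 (nth q0 (q0 :: s) i.+1)))%:E)%E.

Definition strategy (K : finType) (A : arena K) : finType :=
  {ffun {p : K | p \in protagonist A} -> {u : K | u \in nature A}}.

(* None is the absorbing state \bot. *)
Definition chain_state (K : finType) (A : arena K) : finType :=
  option {p : K | p \in protagonist A}.

Definition chain_trans (K : finType) (A : arena K) (mu : K -> K -> rat)
    (sigma : strategy A) (q q' : chain_state A) : rat :=
  match q with
  | None => (q' == None)%:R
  | Some p =>
    if (val p, val (sigma p)) \in edges A then
      match q' with
      | Some p' => mu (val (sigma p)) (val p')
      | None => 0
      end
    else (q' == None)%:R
  end.

Definition target_states (K : finType) (A : arena K) :
    {set chain_state A} :=
  [set Some p | p : {p : K | p \in protagonist A} & val p \in targets A]%SET.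

Definition strategy_prob (R : realType) (K : finType) (A : arena K)
    (mu : K -> K -> rat) (sigma : strategy A)
    (v : {p : K | p \in protagonist A}) : \bar R :=
  reach_prob R (chain_trans mu sigma) (target_states A) (Some v).

Definition max_prob (R : realType) (K : finType) (A : arena K)
    (mu : K -> K -> rat) (v : {p : K | p \in protagonist A}) : \bar R :=
  \big[maxe/-oo%E]_(sigma : strategy A) strategy_prob R mu sigma v.

(* In a target arena succs A u is included in the protagonist vertices when u
   is in V_N, so the sum ranges over all of uE. *)
Definition Val (R : realType) (K : finType) (A : arena K)
    (mu : K -> K -> rat) (v : K) : \bar R :=
  match insub v : option {p : K | p \in protagonist A} with
  | Some p => max_prob R mu p
  | None =>
    (\sum_(p : {p : K | p \in protagonist A} | val p \in succs A v)
       (ratr (mu v (val p)))%:E * max_prob R mu p)%E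
  end.

Definition never_worse (R : realType) (K : finType) (A : arena K)
    (v : K) (W : {set K}) : Prop :=
  forall mu : K -> K -> rat, full_support A mu ->
    exists2 w, w \in W & (Val R A mu v <= Val R A mu w)%E.

Definition nwr_equiv (R : realType) (K : finType) (A : arena K) (v w : K) :
    Prop :=
  never_worse R A v [set w]%SET /\ never_worse R A w [set v]%SET.

Definition nwr_class (R : realType) (K : finType) (A : arena K) (u : K) :
    {set K} :=
  if u \in protagonist A then
    [set v in protagonist A | `[< nwr_equiv R A v u >]]
  else [set v in nature A | `[< nwr_equiv R A v u >]].

Definition nwr_quotient (R : realType) (K : finType) (A : arena K) :
    arena {set K} :=
  let cl := nwr_class R A in
  let SP := [set cl v | v in protagonist A]%SET in
  {| vertices := [set cl v | v in nature A]%SET :|: SP;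
     protagonist := SP;
     edges :=
       [set (cl e.1, cl e.2)
         | e in edges A :&: finset.setX (protagonist A) (nature A)
         & succs A e.2 :\: cl e.1 != finset.set0]%SET
       :|: [set (cl e.1, cl e.2)
             | e in edges A :&: finset.setX (nature A) (protagonist A)]%SET;
     targets := [set cl t | t in targets A]%SET |}.

(* A with each vertex replaced by its singleton *)
Definition singleton_arena (K : finType) (A : arena K) : arena {set K} :=
  {| vertices := [set [set v] | v in vertices A]%SET;
     protagonist := [set [set v] | v in protagonist A]%SET;
     edges := [set ([set e.1], [set e.2]) | e in edges A]%SET;
     targets := [set [set t] | t in targets A]%SET |}.

Definition equals_its_quotient (R : realType) (K : finType) (A : arena K) :
    Prop :=
  nwr_quotient R A = singleton_arena A.

Definition remove_edge (K : finType) (A : arena K) (w x : K) : arena K :=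
  {| vertices := vertices A;
     protagonist := protagonist A;
     edges := edges A :\ (w, x);
     targets := targets A |}.

(* Main.v *)
Require Import Defs.
From mathcomp Require Import all_boot all_order all_algebra.
From mathcomp Require Import all_classical all_reals all_analysis.
From mathcomp Require Import lra.

Set Implicit Arguments.
Unset Strict Implicit.
Unset Printing Implicit Defensive.

Import Order.TTheory GRing.Theory Num.Theory.

Local Open Scope ring_scope.

(* Fix mu and a positional strategy that is optimal from every vertex, and
   suppose it plays w -> x. Take y in wE \ {x} with Val(x) <= Val(y) for this mu
   and let w play y instead. By a maximum principle, the switch can only lower
   the value if it creates a target-free closed set D of vertices with the same
   positive value. Every closed subset of D contains w, since otherwise the
   original strategy would already be trapped there with value 0. Closedness
   depends on the supports only; so, for every other family mu', the minimum of
   Val^mu' on D is attained at w. Hence Val^mu'(y) = Val^mu'(w) and all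
   successors of y are equivalent to w. In an arena that equals its quotient
   this forces yE = {w}, but then (w, y) is not an edge of the quotient. *)

(** * Finite Markov decision processes *)

Section DecisionProcess.

Context {R : realFieldType} {P U : finType}.
Implicit Types (m : U -> P -> R) (E : P -> U -> bool) (T : pred P).
Implicit Types (s : {ffun P -> U}) (f g : P -> R) (D : {set P}).

(** The terms [a p * (c - f p)] are nonnegative and sum to at most 0, so each of them vanishes. *)
Lemma weighted_sum_max_eq (a f : P -> R) (c : R) :
  (forall q, 0 <= a q) -> \sum_q a q = 1 ->
  (forall q, a q != 0 -> f q <= c) -> c <= \sum_q a q * f q ->
  forall q, a q != 0 -> f q = c.
Proof.
move=> a0 a1 fc cle q aq.
have h0 p : 0 <= a p * (c - f p).
  have [->|ap] := eqVneq (a p) 0; first by rewrite mul0r.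
  by rewrite mulr_ge0 ?a0 // subr_ge0 fc.
have hs : \sum_p a p * (c - f p) = 0.
  apply/eqP; rewrite eq_le sumr_ge0 ?andbT //.
  under eq_bigr do rewrite mulrBr.
  by rewrite sumrB -mulr_suml a1 mul1r subr_le0.
have /eqP : a q * (c - f q) = 0 by apply: (psumr_eq0P (fun p _ => h0 p) hs).
by rewrite mulf_eq0 (negbTE aq) /= subr_eq0 => /eqP.
Qed.

Definition step m E s f p : R :=
  if E p (s p) then \sum_q m (s p) q * f q else 0.

Definition closed_under m E s D : Prop :=
  forall p, p \in D ->
    E p (s p) /\ forall q, m (s p) q != 0 -> q \in D.

(** Characterises the reachability probability under [s] as a least fixed point. Leastness is
    against all nonnegative supersolutions, so an upper bound on [r] needs just one such [g]. *)
Definition least_value m E T s (r : P -> R) : Prop :=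
  [/\ forall p, 0 <= r p <= 1,
      forall p, p \in T -> r p = 1,
      forall p, p \notin T -> r p = step m E s r p
    & forall g, (forall p, 0 <= g p) -> (forall p, p \in T -> 1 <= g p) ->
        (forall p, p \notin T -> step m E s g p <= g p) ->
        forall p, r p <= g p].

Variables (m : U -> P -> R) (E : P -> U -> bool) (T : pred P).
Hypothesis m_ge0 : forall u q, 0 <= m u q.
Hypothesis m_sum1 : forall u, \sum_q m u q = 1.

Lemma ler_step s f g p :
  (forall q, f q <= g q) -> step m E s f p <= step m E s g p.
Proof.
move=> fg; rewrite /step; case: ifP => // _.
by apply: ler_sum => q _; rewrite ler_wpM2l.
Qed.

Lemma sum_const_on_support u D f (c : R) :
  (forall q, m u q != 0 -> q \in D) -> (forall q, q \in D -> f q = c) ->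
  \sum_q m u q * f q = c.
Proof.
move=> mD fc; rewrite -[RHS]mul1r -(m_sum1 u) mulr_suml.
apply: eq_bigr => q _; have [->|/mD/fc->//] := eqVneq (m u q) 0.
by rewrite !mul0r.
Qed.

(** The indicator of the complement of [D] is a supersolution, because play from [D] stays in
    [D]. *)
Lemma closed_value_eq0 s (r : P -> R) D :
  least_value m E T s r -> closed_under m E s D ->
  (forall p, p \in D -> p \notin T) -> forall p, p \in D -> r p = 0.
Proof.
move=> [r01 rT rstep rleast] clD DT p pD.
apply/eqP; rewrite eq_le; case/andP: (r01 p) => -> _; rewrite andbT.
suff -> : 0 = (p \notin D)%:R :> R.
  apply: (rleast (fun p => (p \notin D)%:R)) => {p pD} [p|p pT|p pT].
  - exact: ler0n.
  - by have [/DT/negP//|] := boolP (p \in D).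
  - have [pD|pD] := boolP (p \in D).
      have [Ep cl] := clD p pD; rewrite /step Ep.
      by rewrite (sum_const_on_support (c := 0) cl) // => q ->.
    rewrite /step; case: ifP => _; last exact: ler0n.
    apply: (@le_trans _ _ (\sum_q m (s p) q)); last by rewrite m_sum1.
    apply: ler_sum => q _.
    by rewrite ler_piMr //; case: (q \notin D); rewrite ?lexx ?ler01.
by rewrite pD.
Qed.

(* Maximum principle: the states where f exceeds r the most form a closed
   target-free set, on which r vanishes. *)
Lemma subharmonic_le_value s (r : P -> R) f :
  least_value m E T s r ->
  (forall p, p \in T -> f p <= 1) ->
  (forall p, p \notin T -> f p <= step m E s f p) ->
  (forall D (c : R), 0 < c -> D != finset.set0 -> closed_under m E s D ->
     (forall p, p \in D -> p \notin T) -> (forall p, p \in D -> f p = c) ->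
     False) ->
  forall p, f p <= r p.
Proof.
move=> hr fT fstep noD p; rewrite leNgt; apply/negP => lt_rf.
have [r01 rT rstep rleast] := hr.
pose d q := f q - r q.
case: (@Order.TotalTheory.arg_maxP _ _ _ p xpredT d isT) => p0 _ maxd.
have c0 : 0 < d p0.
  by apply: lt_le_trans (maxd p isT); rewrite /d subr_gt0.
pose D := [set q | d q == d p0]%SET.
have DT q : q \in D -> q \notin T.
  rewrite inE => /eqP dq; apply/negP => qT.
  by move: (fT q qT) c0; rewrite -dq /d rT //; lra.
have clD : closed_under m E s D.
  move=> q qD; have qT := DT q qD.
  move: (fstep q qT) (rstep q qT); rewrite /step.
  move: qD; rewrite inE => /eqP dq.
  (* With an available choice, [d q] is at most the average of [d] over the successors, so all of
     them attain the maximum. Otherwise [f q <= 0] and [r q = 0], against [0 < d q]. *)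
  case: ifP => [Eq fq rq|_ fq rq].
    split=> // q'; rewrite inE => mq'; apply/eqP.
    apply: (weighted_sum_max_eq (a := m (s q)) (f := d)) mq' => // [z _|].
      exact: (maxd z).
    rewrite -dq /d; under eq_bigr do rewrite mulrBr.
    by rewrite sumrB -rq lerB.
  by move: c0; rewrite -dq /d rq; lra.
apply: (noD D (d p0) c0 _ clD DT).
  by apply/finset.set0Pn; exists p0; rewrite inE.
move=> q qD; have := closed_value_eq0 hr clD DT qD.
by move: qD; rewrite inE /d => /eqP <- ->; rewrite subr0.
Qed.

Variable val : {ffun P -> U} -> P -> R.
Hypothesis valP : forall s, least_value m E T s (val s).

(* At each state s follows the better of s1 and s2. On a closed set where the
   better value is a constant c, the states with val s1 = c are closed as well,
   so s has a closed subset on which it follows only one of s1 and s2. *)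
Lemma val_join s1 s2 :
  exists s, forall p, val s1 p <= val s p /\ val s2 p <= val s p.
Proof.
pose s := [ffun p => if val s2 p <= val s1 p then s1 p else s2 p].
pose f p := Order.max (val s1 p) (val s2 p).
exists s; suff le_f p : f p <= val s p.
  by move=> p; move: (le_f p); rewrite /f ge_max => /andP[].
have [r01 rT rstep rleast] := valP s1.
have [r01' rT' rstep' rleast'] := valP s2.
have le1 q : val s1 q <= f q by rewrite /f le_max lexx.
have le2 q : val s2 q <= f q by rewrite /f le_max lexx orbT.
apply: (subharmonic_le_value (valP s)) => {p} [p pT|p pT|].
- by rewrite /f ge_max rT // rT' // lexx.
- rewrite /f /step ffunE; case: (leP (val s2 p) (val s1 p)) => _.
    by rewrite [leLHS]rstep // (ler_step s1 p le1).
  by rewrite [leLHS]rstep' // (ler_step s2 p le2).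
move=> D c c0 D0 clD DT fc.
(* The contradiction when [s] follows a single strategy [i] on the part [D'] of [D] where [val i]
   equals [c]. It is applied to [s1] and [D1], or, if [D1] is empty, to [s2] and the whole of
   [D]. *)
have sub (i : {ffun P -> U}) (D' : {set P}) :
    (forall q, val i q <= f q) ->
    (forall p, p \notin T -> val i p = step m E i (val i) p) ->
    (forall p, p \in D' = (p \in D) && (val i p == c)) ->
    (forall p, p \in D' -> s p = i p) -> D' != finset.set0 -> False.
  move=> lei stepi mD' si /finset.set0Pn[p0 p0D'].
  have clD' : closed_under m E i D'.
    move=> p pD'; have := pD'; rewrite mD' => /andP[pD /eqP pc].
    have [Ep cl] := clD p pD; rewrite (si p pD') in Ep cl.
    split=> // q mq; rewrite mD' cl //=; apply/eqP.
    apply: (weighted_sum_max_eq (a := m (i p)) (f := val i)) mq => //.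
      by move=> z /cl zD; rewrite -(fc z zD).
    by rewrite -pc [leLHS]stepi ?DT // /step Ep.
  have D'T p : p \in D' -> p \notin T by rewrite mD' => /andP[/DT].
  have := closed_value_eq0 (valP i) clD' D'T p0D'.
  move: p0D'; rewrite mD' => /andP[_ /eqP ->] c00.
  by rewrite c00 ltxx in c0.
pose D1 := [set p in D | val s1 p == c]%SET.
have [D10|D1n] := eqVneq D1 finset.set0; last first.
  apply: (sub s1 D1 le1 rstep) => // p; rewrite !inE // => /andP[pD /eqP pc].
  by rewrite ffunE ifT // pc -(fc p pD).
have D2 p : p \in D -> val s2 p = c /\ val s1 p < c.
  move=> pD; have : p \notin D1 by rewrite D10 inE.
  rewrite inE pD /= => n1.
  have lt1 : val s1 p < c by rewrite lt_neqAle n1 -(fc p pD) le1.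
  split=> //; move: (fc p pD); rewrite /f /Order.max; case: ifP => // _ h.
  by rewrite h eqxx in n1.
apply: (sub s2 D le2 rstep') => // p; last first.
  by move/D2 => [p2 p1]; rewrite ffunE ifF // p2 leNgt p1.
by have [/D2[-> _]|//] := boolP (p \in D); rewrite eqxx.
Qed.

(** Take [so] with the largest sum of values over all states. Its join with any [s] cannot have a
    larger sum, hence agrees with [so] in value everywhere. *)
Lemma optimal_strategy (s0 : {ffun P -> U}) :
  exists so, forall s p, val s p <= val so p.
Proof.
pose total s := \sum_p val s p.
case: (@Order.TotalTheory.arg_maxP _ _ _ s0 xpredT total isT)
  => so _ maxo; exists so => s p.
have [s' hs'] := val_join so s.
have /eqP e : \sum_q (val s' q - val so q) = 0.
  apply/eqP; rewrite eq_le sumr_ge0 ?andbT; last first.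
    by move=> q _; rewrite subr_ge0; case: (hs' q).
  by rewrite sumrB subr_le0; exact: (maxo s').
have h0 q : true -> 0 <= val s' q - val so q.
  by move=> _; rewrite subr_ge0; case: (hs' q).
have /eqP : val s' p - val so p = 0 by apply: (psumr_eq0P h0 (eqP e)).
by rewrite subr_eq0 => /eqP <-; case: (hs' p).
Qed.

Definition switch s w y : {ffun P -> U} :=
  [ffun p => if p == w then y else s p].

(** Away from [w] the switch changes nothing, so a set [D] without [w] would be closed under [s]
    itself, which would then have value 0 there. *)
Lemma closed_switch_mem s w y D (c : R) :
  0 < c -> D != finset.set0 -> closed_under m E (switch s w y) D ->
  (forall p, p \in D -> p \notin T) -> (forall p, p \in D -> val s p = c) ->
  w \in D.
Proof.
move=> c0 /finset.set0Pn[p0 p0D] clD DT fc; apply/negPn/negP => wD.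
have clD' : closed_under m E s D.
  move=> p pD; have := clD p pD; rewrite ffunE ifF //.
  by apply: contraNF wD => /eqP <-.
have := closed_value_eq0 (valP s) clD' DT p0D.
by rewrite fc // => c00; rewrite c00 ltxx in c0.
Qed.

Variable so : {ffun P -> U}.
Hypothesis so_opt : forall s p, val s p <= val so p.

Lemma val_step_switch w y p : p \notin T ->
  (w \notin T -> val so w <= \sum_q m y q * val so q) -> E w y ->
  val so p <= step m E (switch so w y) (val so) p.
Proof.
move=> pT h Ewy; rewrite /step ffunE; case: eqVneq => [pw|_].
  by rewrite pw in pT *; rewrite Ewy h.
by have [_ _ st _] := valP so; rewrite [leLHS]st.
Qed.

(* If the average over u beat the optimal value at p, switching p to u would
   improve on the optimum. *)
Lemma optimal_ge_average p u : p \notin T -> E p u ->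
  \sum_q m u q * val so q <= val so p.
Proof.
move=> pT Epu; rewrite leNgt; apply/negP => lt_p.
have le_so : forall q, val so q <= val (switch so p u) q.
  apply: (subharmonic_le_value (valP _)) => [q qT|q qT|].
  - by have [_ -> //] := valP so.
  - by apply: val_step_switch => // _; apply: ltW.
  (* Such a [D] contains [p] and all successors of [u], so the average over [u] would be [c], the
     value at [p]. *)
  move=> D c c0 D0 clD DT fc.
  have pD := closed_switch_mem c0 D0 clD DT fc.
  have [] := clD p pD; rewrite ffunE eqxx => _ cl.
  by move: lt_p; rewrite (sum_const_on_support cl fc) fc // ltxx.
have [_ _ st _] := valP (switch so p u).
have := so_opt (switch so p u) p; rewrite leNgt => /negP; apply.
rewrite [ltRHS]st // /step ffunE eqxx Epu.
apply: lt_le_trans lt_p _; apply: ler_sum => q _.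
by rewrite ler_wpM2l.
Qed.

End DecisionProcess.

(* The minimum of a superharmonic g on D is attained at w, because the argmin is
   itself closed. *)
Lemma superharmonic_ge_on_closed (R : realFieldType) (P U : finType)
    (m : U -> P -> R) (E : P -> U -> bool) (s : {ffun P -> U}) (D : {set P})
    (w : P) (g : P -> R) :
  (forall u q, 0 <= m u q) -> (forall u, \sum_q m u q = 1) ->
  closed_under m E s D ->
  (forall D' : {set P}, D' \subset D -> D' != finset.set0 ->
     closed_under m E s D' -> w \in D') ->
  (forall p, p \in D -> \sum_q m (s p) q * g q <= g p) ->
  forall p, p \in D -> g w <= g p.
Proof.
move=> m0 m1 clD hw sup p pD.
case: (@Order.TotalTheory.arg_minP _ _ _ p (mem D) g pD) => p0 p0D ming.
pose M := [set q in D | g q == g p0]%SET.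
suff : w \in M by rewrite inE => /andP[_ /eqP ->]; apply: ming.
apply: hw => [||q].
- by apply/fintype.subsetP => q; rewrite inE => /andP[].
- by apply/finset.set0Pn; exists p0; rewrite inE eqxx andbT; exact: p0D.
rewrite inE => /andP[qD /eqP gq]; have [Eq cl] := clD q qD; split=> // z mz.
rewrite inE (cl z mz) /=; apply/eqP/oppr_inj.
apply: (weighted_sum_max_eq (a := m (s q)) (f := fun z => - g z)) mz => //.
  by move=> x mx; rewrite lerN2; apply: ming; apply: cl.
under eq_bigr do rewrite mulrN.
by rewrite sumrN lerN2 -gq; apply: sup.
Qed.

(** [r'] is a supersolution for [E]: the steps agree where [s] is available in [E], and elsewhere
    the step for [E] is 0. *)
Lemma least_value_mono (R : realFieldType) (P U : finType) (m : U -> P -> R)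
    (E E' : P -> U -> bool) (T : pred P) (s : {ffun P -> U}) (r r' : P -> R) :
  (forall u q, 0 <= m u q) -> (forall p, E p (s p) -> E' p (s p)) ->
  least_value m E T s r -> least_value m E' T s r' -> forall p, r p <= r' p.
Proof.
move=> m0 EE' [_ _ _ rleast] [r01 rT rstep _]; apply: rleast => p.
- by case/andP: (r01 p).
- by move/rT ->.
move=> pT; rewrite [leRHS]rstep // /step.
case: ifP => [/EE' -> //|_]; case: ifP => // _.
by apply: sumr_ge0 => q _; rewrite mulr_ge0 //; case/andP: (r01 q).
Qed.

(** * Reachability probabilities as least fixed points *)

Lemma big_tuple_recl (V : Type) (idx : V) (op : Monoid.com_law idx)
    (Q : finType) n (p : pred (n.+1.-tuple Q)) (F : n.+1.-tuple Q -> V) :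
  \big[op/idx]_(s : n.+1.-tuple Q | p s) F s =
  \big[op/idx]_(q : Q) \big[op/idx]_(s : n.-tuple Q | p [tuple of q :: s])
     F [tuple of q :: s].
Proof.
rewrite pair_big_dep /=.
rewrite (reindex (fun qs : Q * n.-tuple Q => [tuple of qs.1 :: qs.2])) //=.
apply: onW_bij; exists (fun s => (thead s, [tuple of behead s])).
  by move=> [q s]; congr pair; apply: val_inj.
by move=> s; rewrite [RHS]tuple_eta; apply: val_inj.
Qed.

Section ReachProb.

Context {R : realType} {Q : finType} (delta : Q -> Q -> rat) (T' : {set Q}).
Hypothesis delta_ge0 : forall q q', 0 <= delta q q'.

(** Conditioning on the first move gives the recursion. A start in [T'] is hit at time 0, hence the
    0 at positive times. *)
Fixpoint first_hit n q : R :=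
  if n is k.+1 then
    if q \in T' then 0 else \sum_q' ratr (delta q q') * first_hit k q'
  else (q \in T')%:R.

Lemma first_hit_ge0 n q : 0 <= first_hit n q.
Proof.
elim: n q => [|n IH] q /=; first exact: ler0n.
case: ifP => // _; apply: sumr_ge0 => q' _.
by rewrite mulr_ge0 // ler0q.
Qed.

Lemma sum_first_hit n q :
  \sum_(s : n.-tuple Q |
        all (fun q => q \notin T') (belast q s) && (last q s \in T'))
    \prod_(i < n) ratr (delta (nth q (q :: s) i) (nth q (q :: s) i.+1))
  = first_hit n q.
Proof.
elim: n q => [|n IH] q.
  under eq_bigr do rewrite big_ord0.
  rewrite big_mkcond (big_pred1 [tuple]) /=; first by case: ifP.
  by move=> t; apply/esym/eqP; apply: tuple0.
rewrite big_tuple_recl /=; case: ifP => qT /=.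
  by rewrite big1 // => q' _; rewrite big_pred0.
apply: eq_bigr => q' _; rewrite -IH mulr_sumr; apply: eq_bigr => s _.
rewrite big_ord_recl /=; congr (_ * _); apply: eq_bigr => i _.
(* The default of [nth] changes from [q] to [q'], harmlessly, since all indices are in range. *)
have lti : (i < (size s).+1)%N by rewrite size_tuple ltnW // ltnS.
rewrite /= add0n; congr (ratr (delta _ _)); apply: set_nth_default => //.
by rewrite size_tuple.
Qed.

Lemma reach_probE q :
  reach_prob R delta T' q = (\sum_(0 <= n <oo) (first_hit n q)%:E)%E.
Proof.
have h0 n : true -> (0 <= (first_hit n q)%:E)%E.
  by rewrite lee_fin first_hit_ge0.
rewrite nneseries_recl // /reach_prob /=.
case: ifP => qT.
  by rewrite eseries0 ?adde0 // => -[//|n] _ _ /=; rewrite qT.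
rewrite add0e; apply: eq_eseriesr => n _; rewrite -sum_first_hit.
by rewrite sumEFin.
Qed.

Lemma reach_prob_ge0 q : (0 <= reach_prob R delta T' q)%E.
Proof.
rewrite reach_probE nneseries_ge0 // => n _ _.
by rewrite lee_fin first_hit_ge0.
Qed.

Lemma reach_prob_step q : q \notin T' ->
  reach_prob R delta T' q =
  (\sum_q' (ratr (delta q q'))%:E * reach_prob R delta T' q')%E.
Proof.
move=> qT; rewrite reach_probE.
transitivity (\sum_q' \sum_(0 <= n <oo)
    (ratr (delta q q'))%:E * (first_hit n q')%:E)%E; last first.
  apply: eq_bigr => q' _; rewrite nneseriesZl ?reach_probE // => n _.
  by rewrite lee_fin first_hit_ge0.
rewrite -nneseries_sum; last first.
  by move=> q' n _; rewrite lee_fin mulr_ge0 ?first_hit_ge0 // ler0q.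
rewrite nneseries_recl //; last by move=> n _; rewrite lee_fin first_hit_ge0.
rewrite /= (negbTE qT) add0e.
rewrite -(nneseries_addn 1 (f := fun n => (first_hit n q)%:E)).
  by apply: eq_eseriesr => n _; rewrite addn1 /= (negbTE qT) -sumEFin.
by move=> n; rewrite lee_fin first_hit_ge0.
Qed.

(** Each partial sum is one step applied to the previous one, so by induction all of them stay below
    the supersolution [g]. *)
Lemma reach_prob_le (g : Q -> R) :
  (forall q, 0 <= g q) -> (forall q, q \in T' -> 1 <= g q) ->
  (forall q, q \notin T' -> \sum_q' ratr (delta q q') * g q' <= g q) ->
  forall q, (reach_prob R delta T' q <= (g q)%:E)%E.
Proof.
move=> g0 gT gstep q; rewrite reach_probE.
apply: lime_le.
  by apply: is_cvg_nneseries => n _ _; rewrite lee_fin first_hit_ge0.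
apply: nearW => n; rewrite sumEFin lee_fin.
elim: n q => [|n IH] q; first by rewrite big_geq.
rewrite big_nat_recl //=; have [qT|qT] := boolP (q \in T').
  by rewrite big1 ?addr0 ?gT.
rewrite add0r exchange_big /=; apply: le_trans (gstep q qT).
by apply: ler_sum => q' _; rewrite -mulr_sumr ler_wpM2l ?ler0q.
Qed.

End ReachProb.

(** * Arenas *)

Lemma big_option_recl (V : Type) (idx : V) (op : Monoid.com_law idx)
    (I : finType) (F : option I -> V) :
  \big[op/idx]_(i : option I) F i =
  op (F None) (\big[op/idx]_(i : I) F (Some i)).
Proof.
rewrite (bigD1 None) //=; congr (op _ _).
rewrite (reindex_omap Some id) /=; first by apply: eq_bigl => i; rewrite eqxx.
by case.
Qed.

Section StrategyProb.

Context {R : realType} {K : finType} (A : arena K) (mu : K -> K -> rat).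
Let P : finType := {p : K | p \in protagonist A}.
Let U : finType := {u : K | u \in nature A}.

Definition nature_prob (u : U) (q : P) : R := ratr (mu (val u) (val q)).
Definition available (p : P) (u : U) : bool := (val p, val u) \in edges A.
Definition is_target : pred P := [pred p | val p \in targets A].
Definition prob (s : {ffun P -> U}) (p : P) : R :=
  fine (strategy_prob R mu (s : strategy A) p).

Hypothesis prob_ge0 : forall u q, 0 <= nature_prob u q.
Hypothesis prob_sum1 : forall u, \sum_q nature_prob u q = 1.
Implicit Types (s : strategy A).

Lemma chain_trans_ge0 s q q' : 0 <= chain_trans mu s q q'.
Proof.
case: q => [p|] /=; last exact: ler0n.
case: ifP => _; last exact: ler0n.
by case: q' => // p'; move: (prob_ge0 (s p) p'); rewrite /nature_prob ler0q.
Qed.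

Lemma chain_trans_sum1 s q :
  \sum_q' ratr (chain_trans mu s q q') = 1 :> R.
Proof.
rewrite big_option_recl; case: q => [p|] /=; last first.
  by rewrite rmorph1 big1 ?addr0 // => i _; rewrite rmorph0.
case: ifP => _; first by rewrite rmorph0 add0r prob_sum1.
by rewrite rmorph1 big1 ?addr0 // => i _; rewrite rmorph0.
Qed.

Lemma Some_in_target_states (p : P) :
  (Some p \in target_states A) = (p \in is_target).
Proof.
apply/imsetP/idP => [[q] + [->]|pT]; first by rewrite inE.
by exists p; rewrite ?inE.
Qed.

Lemma None_in_target_states : (None \in target_states A) = false.
Proof. by apply/imsetP => -[]. Qed.

(** The bound is itself a supersolution. It yields both finiteness and the value 0 of the sink. *)
Lemma reach_prob_chain_le s q :
  (reach_prob R (chain_trans mu s) (target_states A) q <=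
   ((q != None)%:R)%:E)%E.
Proof.
apply: (reach_prob_le (@chain_trans_ge0 s) (g := fun q => (q != None)%:R))
  => {q}.
- by move=> q; apply: ler0n.
- by case=> [p|]; rewrite ?None_in_target_states // => _; apply: lexx.
case=> [p|] _ /=.
  rewrite -[leRHS](chain_trans_sum1 s (Some p)); apply: ler_sum => q _.
  rewrite ler_piMr //; last by case: (q != None); rewrite ?lexx ?ler01.
  by rewrite ler0q; exact: (chain_trans_ge0 s (Some p) q).
rewrite big_option_recl /= mulr0 add0r big1 // => i _.
by rewrite rmorph0 mul0r.
Qed.

Lemma reach_prob_None s :
  reach_prob R (chain_trans mu s) (target_states A) None = 0%E.
Proof.
apply/eqP; rewrite eq_le reach_prob_ge0 ?andbT; last exact: chain_trans_ge0.
exact: (reach_prob_chain_le s None).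
Qed.

Lemma strategy_probE (s : {ffun P -> U}) p :
  strategy_prob R mu (s : strategy A) p = (prob s p)%:E.
Proof.
rewrite fineK // ge0_fin_numE; last exact/reach_prob_ge0/chain_trans_ge0.
by apply: le_lt_trans (reach_prob_chain_le s (Some p)) _; rewrite ltry.
Qed.

(** The sink has value 0, so it drops out of the one-step equation, and a supersolution [g] extends
    to it by 0. This carries the results on decision processes over to arenas. *)
Lemma prob_least_value (s : {ffun P -> U}) :
  least_value nature_prob available is_target s (prob s).
Proof.
split=> [p|p pT|p pT|g g0 gT gstep p].
- rewrite -!lee_fin -strategy_probE; apply/andP; split.
    exact/reach_prob_ge0/chain_trans_ge0.
  exact: (reach_prob_chain_le s (Some p)).
- by rewrite /prob /strategy_prob /reach_prob Some_in_target_states pT.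
- apply: EFin_inj; rewrite -strategy_probE /strategy_prob.
  rewrite reach_prob_step; last first.
  - by rewrite Some_in_target_states.
  - exact: chain_trans_ge0.
  rewrite big_option_recl reach_prob_None mule0 [LHS]add0e /step.
  under eq_bigr => q _ do
    rewrite -/(strategy_prob R mu (s : strategy A) q) strategy_probE -EFinM.
  rewrite sumEFin /= /available; case: ifP => // _.
  by congr EFin; apply: big1 => q _; rewrite rmorph0 mul0r.
rewrite -lee_fin -strategy_probE.
apply: (reach_prob_le (@chain_trans_ge0 s) (g := fun q => oapp g 0 q)).
- by case.
- case=> [q|]; rewrite ?None_in_target_states //.
  by rewrite Some_in_target_states => /gT.
case=> [q|]; last first.
  rewrite big_option_recl /= mulr0 add0r big1 // => i _.
  by rewrite rmorph0 mul0r.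
rewrite Some_in_target_states => /gstep; apply: le_trans.
rewrite big_option_recl /= mulr0 add0r /step /available; case: ifP => // _.
by rewrite big1 // => i _; rewrite rmorph0 mul0r.
Qed.

Lemma max_probE (so : {ffun P -> U}) p : (forall s q, prob s q <= prob so q) ->
  max_prob R mu p = (prob so p)%:E.
Proof.
move=> opt; apply/eqP; rewrite eq_le; apply/andP; split.
  by apply: bigmax_le => [|s _]; rewrite ?leNye // strategy_probE lee_fin.
rewrite -strategy_probE.
exact: (le_bigmax_cond _ (fun s : strategy A => strategy_prob R mu s p)).
Qed.

End StrategyProb.

(** * Target arenas and their quotients *)

Section TargetArena.

Context {R : realType} {K : finType} (A : arena K).
Hypothesis hA : target_arena A.
Let P : finType := {p : K | p \in protagonist A}.
Let U : finType := {u : K | u \in nature A}.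

Lemma nature_notin_protagonist u : u \in nature A -> u \notin protagonist A.
Proof. by rewrite finset.in_setD => /andP[]. Qed.

Lemma succs_nature u q :
  u \in nature A -> q \in succs A u -> q \in protagonist A.
Proof.
move=> uN; have [_ /fintype.subsetP sE _ _] := hA; rewrite inE => /sE.
rewrite !inE /=; case/orP => /andP[//].
by rewrite (negbTE (nature_notin_protagonist uN)).
Qed.

Lemma succs_protagonist p u : p \in protagonist A -> u \in succs A p ->
  u \in nature A.
Proof.
move=> pP; have [_ /fintype.subsetP sE _ _] := hA; rewrite inE => /sE.
rewrite !inE /=; case/orP => /andP[//].
by rewrite pP.
Qed.

Lemma nature_prob_ge0 mu : full_support A mu ->
  forall (u : U) (q : P), 0 <= nature_prob mu u q :> R.
Proof.
move=> hmu u q; have [pos zero _] := hmu _ (valP u).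
rewrite /nature_prob ler0q.
have [/pos/ltW//|/zero -> //] := boolP (val q \in succs A (val u)).
Qed.

Lemma nature_prob_neq0 mu : full_support A mu ->
  forall (u : U) (q : P),
    ((nature_prob mu u q : R) != 0) = (val q \in succs A (val u)).
Proof.
move=> hmu u q; have [pos zero _] := hmu _ (valP u).
rewrite /nature_prob fmorph_eq0.
by have [/pos/lt0r_neq0//|/zero ->] := boolP (_ \in succs A _); rewrite eqxx.
Qed.

Lemma nature_prob_sum1 mu : full_support A mu ->
  forall u : U, \sum_(q : P) nature_prob mu u q = 1 :> R.
Proof.
move=> hmu u; have [_ zero sum1] := hmu _ (valP u).
rewrite -(rmorph1 (ratr : rat -> R)) -sum1 rmorph_sum /=.
have sP := fun q => @succs_nature (val u) q (valP u).
rewrite (eq_bigl (fun q => (q \in protagonist A) && (q \in succs A (val u)))).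
  rewrite big_sub_cond [RHS]big_mkcond; apply: eq_bigr => q _ /=.
  by case: ifPn => // /zero; rewrite /nature_prob => ->; rewrite rmorph0.
by move=> q; have [/sP ->|] := boolP (q \in succs _ _); rewrite ?andbF.
Qed.

Lemma Val_optimal mu (so : {ffun P -> U}) : full_support A mu ->
  (forall s q, prob mu s q <= prob mu so q :> R) ->
  (forall p : P, Val R A mu (val p) = (prob mu so p)%:E) /\
  (forall u : U, Val R A mu (val u) =
     (\sum_q nature_prob mu u q * prob mu so q)%:E).
Proof.
move=> hmu opt.
have m0 := nature_prob_ge0 hmu; have m1 := nature_prob_sum1 hmu.
split=> [p|u]; rewrite /Val.
  by rewrite valK; apply: max_probE.
rewrite insubF; last exact/negbTE/nature_notin_protagonist/valP.
rewrite -sumEFin big_mkcond /=; apply: eq_bigr => q _.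
rewrite (max_probE m0 m1 q opt) -EFinM; case: ifPn => //.
by rewrite -(nature_prob_neq0 hmu) negbK /nature_prob => /eqP ->; rewrite mul0r.
Qed.

Lemma nwr_equiv_refl u : nwr_equiv R A u u.
Proof. by split=> mu _; exists u; rewrite ?finset.in_set1. Qed.

Lemma mem_nwr_class u : u \in vertices A -> u \in nwr_class R A u.
Proof.
move=> uV; rewrite /nwr_class; case: ifPn => uP; rewrite !inE ?uP ?uV /=;
  exact/asboolP/nwr_equiv_refl.
Qed.

Hypothesis hq : equals_its_quotient R A.

(** Comparing vertex sets shows that the class is some singleton; it contains [u] by reflexivity. *)
Lemma nwr_class_singleton u : u \in vertices A -> nwr_class R A u = [set u]%SET.
Proof.
move=> uV; have := congr1 (@vertices _) hq => /= eV.
have : nwr_class R A u \in [set [set v] | v in vertices A]%SET.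
  rewrite -eV inE; have [uP|uP] := boolP (u \in protagonist A).
    by rewrite [X in _ || X](imset_f _ uP) orbT.
  by rewrite imset_f // inE uP.
case/imsetP => v _ cv; have := mem_nwr_class uV.
by rewrite cv inE => /eqP ->.
Qed.

(** The quotient keeps an edge leaving a protagonist vertex only if some successor of its head lies
    outside the class of its tail, here the singleton of [w]. *)
Lemma succs_not_sub_singleton w y : w \in protagonist A ->
  (w, y) \in edges A -> exists2 z, z \in succs A y & z != w.
Proof.
have [/fintype.subsetP PV _ _ _] := hA.
move=> wP wy; have := congr1 (@edges _) hq => /= eE.
have : ([set w], [set y])%SET \in
    [set ([set e.1], [set e.2]) | e in edges A]%SET.
  by apply/imsetP; exists (w, y).
rewrite -eE inE => /orP[] /imsetP[[a b]] /=; rewrite !inE /=.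
  move=> /andP[/andP[_ /andP[/PV aV /andP[_ bV]]] h] [].
  rewrite !nwr_class_singleton //.
  move=> /set1_inj wa /set1_inj yb; move: h; rewrite nwr_class_singleton //.
  case/finset.set0Pn => z; rewrite !inE -wa -yb => /andP[zw zy].
  by exists z; rewrite ?inE.
move=> /andP[_ /andP[/andP[aP aV] bP]] [].
rewrite nwr_class_singleton // => /set1_inj wa.
by rewrite -wa wP in aP.
Qed.

Lemma prob_le_switch mu (so : {ffun P -> U}) (w : P) (y : U) :
  full_support A mu -> (forall s q, prob mu s q <= prob mu so q :> R) ->
  available w y ->
  (w \notin is_target (A := A) ->
     prob mu so w <= \sum_q nature_prob mu y q * prob mu so q :> R) ->
  forall p, prob mu so p <= prob mu (switch so w y) p :> R.
Proof.
move=> hmu opt Ewy le_wy.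
have m0 := nature_prob_ge0 hmu; have m1 := nature_prob_sum1 hmu.
have valA := prob_least_value m0 m1.
apply: (subharmonic_le_value m0 m1 (valA _)) => [p pT|p pT|D c c0 D0 clD DT fc].
- by have [_ -> //] := valA so.
- exact: (val_step_switch valA).
pose closed_in mu' :=
  closed_under (nature_prob (R := R) mu') (@available _ A) (switch so w y).
have memw (D' : {set P}) : D' \subset D -> D' != finset.set0 ->
    closed_in mu D' -> w \in D'.
  move=> /fintype.subsetP D'D D'0 clD'.
  apply: (closed_switch_mem m0 m1 valA c0 D'0 clD') => p /D'D.
    exact: DT.
  exact: fc.
have wD := memw D (fintype.subxx D) D0 clD.
(* All full-support families have the same supports, hence the same closed sets. *)
have closed_mu mu1 mu2 D' : full_support A mu1 -> full_support A mu2 ->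
    closed_in mu1 D' ->
    closed_in mu2 D'.
  move=> h1 h2 cl p /cl[Ep sub]; split=> // q.
  by rewrite (nature_prob_neq0 h2) -(nature_prob_neq0 h1); apply: sub.
have [z zy zw] := succs_not_sub_singleton (valP w) Ewy.
have zP := succs_nature (valP y) zy.
pose zp : P := exist _ z zP.
(* Equal values for every [mu'] put [z] into the class of [w], a singleton, against [z != w]. *)
suff Vzw mu' : full_support A mu' -> Val R A mu' z = Val R A mu' (val w).
  have [/fintype.subsetP PV _ _ _] := hA.
  move/negP: zw; apply; rewrite -finset.in_set1.
  rewrite -nwr_class_singleton ?PV ?(valP w) //.
  rewrite /nwr_class (valP w) !inE zP /=; apply/asboolP.
  by split=> mu' hmu'; eexists; rewrite ?finset.in_set1 // ?Vzw.
move=> hmu'.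
have m0' := nature_prob_ge0 hmu'; have m1' := nature_prob_sum1 hmu'.
have valA' := prob_least_value m0' m1'.
have [so' opt'] := optimal_strategy m0' m1' valA' so.
have [Vp _] := Val_optimal hmu' opt'.
rewrite -[z]/(val zp) !Vp; congr EFin.
have clD' := closed_mu mu mu' D hmu hmu' clD.
(* The optimal value for [mu'] is superharmonic on [D] along the switched strategy, so it is least
   at [w]. *)
have geD : forall p, p \in D -> prob (R := R) mu' so' w <= prob mu' so' p.
  apply: (superharmonic_ge_on_closed m0' m1' clD') => [D' sD D'0 cl'|p pD].
    by apply: memw => //; apply: closed_mu cl'.
  apply: (optimal_ge_average m0' m1' valA' opt'); first exact: DT.
  by have [] := clD p pD.
have [_ suby] := clD' w wD; rewrite ffunE eqxx in suby.
(* The successors of [y] lie in [D] and have at least the value of [w], while their average is at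
   most that value; so all are equal. Negation turns this minimum into a maximum. *)
apply: oppr_inj.
apply: (weighted_sum_max_eq (a := nature_prob mu' y)
  (f := fun q => - prob mu' so' q)).
- by move=> q; apply: m0'.
- exact: m1'.
- by move=> q /suby qD; rewrite lerN2; apply: geD.
- under eq_bigr do rewrite mulrN.
  rewrite sumrN lerN2; apply: (optimal_ge_average m0' m1' valA' opt') => //.
  exact: DT.
by rewrite (nature_prob_neq0 hmu').
Qed.

End TargetArena.

Theorem theorem2 (R : realType) (K : finType) (A : arena K)
    (hA : target_arena A) (hq : equals_its_quotient R A)
    (mu : K -> K -> rat) (hmu : full_support A mu)
    (w x : K)
    (hwx : (w, x) \in edges A :&: finset.setX (protagonist A) (nature A))
    (hx : never_worse R A x (succs A w :\ x))
    (v : {p : K | p \in protagonist A}) :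
  \big[maxe/-oo%E]_(sigma : strategy A) strategy_prob R mu sigma v =
  \big[maxe/-oo%E]_(sigma' : strategy (remove_edge A w x))
     strategy_prob R (A := remove_edge A w x) mu sigma' v.
Proof.
move: hwx; rewrite !finset.inE /= => /andP[Ewx /andP[wP xN']].
have xN : x \in nature A by rewrite finset.inE.
have [y] := hx mu hmu; rewrite !finset.inE => /andP[yx Ewy] le_xy.
have yN : y \in nature A.
  by apply: (succs_protagonist hA wP); rewrite finset.inE.
pose wp : {p : K | p \in protagonist A} := exist _ w wP.
pose xu : {u : K | u \in nature A} := exist _ x xN.
pose yu : {u : K | u \in nature A} := exist _ y yN.
have m0 := nature_prob_ge0 (R := R) hmu.
have m1 := nature_prob_sum1 (R := R) hA hmu.
have valA := prob_least_value m0 m1.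
have valB := prob_least_value (A := remove_edge A w x) m0 m1.
have [so opt] := optimal_strategy m0 m1 valA [ffun=> xu].
(* [s'] is [so] itself if that avoids [x] at [w], and otherwise [so] switched to [y]. *)
have [s' s'w le_s'] : exists2 s' : {ffun _ -> _}, s' wp != xu &
    forall p, prob (R := R) mu so p <= prob mu s' p.
  have [so_x|so_x] := eqVneq (so wp) xu; last by exists so.
  exists (switch so wp yu); first by rewrite ffunE eqxx -val_eqE.
  apply: (prob_le_switch hA hq) => // wT.
  have [_ Vu] := Val_optimal hA hmu opt.
  have [_ _ st _] := valA so.
  rewrite [leLHS]st // /step so_x /available Ewx.
  by move: le_xy; rewrite -[x]/(val xu) -[y]/(val yu) !Vu lee_fin.
apply/eqP; rewrite eq_le; apply/andP; split.
  apply: bigmax_le => [|s _]; first by rewrite leNye.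
  (* Both arenas have the same strategies, and [s'] never uses the removed edge, so it loses
     nothing. *)
  apply: (bigmax_sup (s' : strategy (remove_edge A w x))) => //.
  rewrite (strategy_probE m0 m1).
  rewrite (strategy_probE (A := remove_edge A w x) m0 m1) lee_fin.
  apply: le_trans (opt s v) _; apply: le_trans (le_s' v) _.
  apply: (least_value_mono m0 _ (valA s') (valB s')) => p.
  rewrite /available !finset.inE /= => ->; rewrite andbT.
  apply: contra s'w; rewrite xpair_eqE -val_eqE => /andP[/eqP pw /eqP sx].
  by have -> : wp = p by [apply: val_inj]; apply/eqP.
apply: bigmax_le => [|s _]; first by rewrite leNye.
(* Conversely, the same strategy does at least as well with the additional edge. *)
apply: (bigmax_sup (s : strategy A)) => //.
rewrite (strategy_probE m0 m1).
rewrite (strategy_probE (A := remove_edge A w x) m0 m1) lee_fin.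
apply: (least_value_mono m0 _ (valB s) (valA s)) => p.
by rewrite /available !finset.inE /= => /andP[].
Qed.
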